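(* Let $g'$, $g''$, and $f$ be $R'$-, $R''$-, and $S$-perfect colorings of graphs $G'$, $G''$, and of their cartesian product $G=G'\times G''$, respectively. Let $h=(g'\otimes g'')^{T}f$ be the distribution of $f$ with respect to the perfect coloring $g'\otimes g''$ of $G$, and let $h^*$ be its rearrangement. Then $h^*$ is an $(I\otimes S-R''\otimes I)$-perfect structure over $R'^{T}$; that is, $R'^{T}h^*=h^*(I\otimes S-R''\otimes I)$.
   Context: All graphs are finite and simple. For a graph $G=(V,E)$ with adjacency matrix $A$, a coloring of $V$ with exactly $\nu$ colors $e_0,\dots,e_{\nu-1}$ (where $e_i$ is the tuple of length $\nu$ with $1$ in position $i$ and $0$ elsewhere) is represented by the $|V|\times\nu$ matrix whose row indexed by $v$ is the color of $v$. It is an $S$-perfect coloring, $S=(S_{ij})_{i,j=0}^{\nu-1}$, if every vertex of color $e_i$ has exactly $S_{ij}$ neighbors of color $e_j$ for all $i,j$; equivalently $Af=fS$. In general, for real matrices, $f$ is an $S$-perfect structure over a square matrix $A$ if $Af=fS$. The cartesian product $G'\times G''$ of $G'=(V',E')$ and $G''=(V'',E'')$ has vertex set $V'\times V''$; $(u',u'')$ and $(v',v'')$ are adjacent iff either $u'=v'$ and $\{u'',v''\}\in E''$, or $\{u',v'\}\in E'$ and $u''=v''$. The tensor product of matrices $A'=(a'_{ij})$ and $A''=(a''_{ij})$ is the matrix $A'\otimes A''$ with rows indexed by pairs $(i',i'')$ and columns by pairs $(j',j'')$ and with entries $a'_{i'j'}a''_{i''j''}$. $I$ denotes identity matrices of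 the appropriate sizes. Let $\mu',\mu'',\nu$ be the numbers of colors of $g',g'',f$. The $\mu'\mu''\times\nu$ matrix $h$ has entries $h_{i'i''j}$, with rows indexed by pairs $(i',i'')$ of colors of $g'$ and $g''$ and columns by colors $j$ of $f$. The rearrangement $h^*$ is the $\mu'\times\mu''\nu$ matrix with the same entries $h_{i'i''j}$, where $i'$ is the row index and the pair $(i'',j)$ is the column index. In $I\otimes S-R''\otimes I$, the first tensor factor ($\mu''\times\mu''$) corresponds to the index $i''$ and the second ($\nu\times\nu$) to the index $j$. *)

(* Defs.v *)
From mathcomp Require Import all_boot all_order all_algebra.
From mathcomp Require Import mxtens.
From mathcomp Require Import reals.

Set Implicit Arguments.
Unset Strict Implicit.
Unset Printing Implicit Defensive.

Import GRing.Theory.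
Local Open Scope ring_scope.

Record sgraph := SGraph {
  vertex :> finType;
  adj : rel vertex;
  adj_sym : symmetric adj;
  adj_irrefl : irreflexive adj }.

Section Cartesian.
Variables G1 G2 : sgraph.

Definition cart_adj : rel (G1 * G2) :=
  fun u v => ((u.1 == v.1) && adj u.2 v.2) || (adj u.1 v.1 && (u.2 == v.2)).

Lemma cart_adj_sym : symmetric cart_adj.
Proof.
move=> u v; rewrite /cart_adj.
by rewrite (adj_sym u.1) (adj_sym u.2) (eq_sym u.1) (eq_sym u.2).
Qed.

Lemma cart_adj_irrefl : irreflexive cart_adj.
Proof. by move=> u; rewrite /cart_adj !adj_irrefl andbF. Qed.

Definition cartesian : sgraph := SGraph cart_adj_sym cart_adj_irrefl.

End Cartesian.

(* The color e_i, the i-th unit row vector, is identified with its index i.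
   The colors are exactly e_0, ..., e_(nu-1), so each of them has to occur. *)
Definition perfect_coloring (R : realType) (G : sgraph) (nu : nat)
    (S : 'M[R]_nu) (c : G -> 'I_nu) : Prop :=
  (forall i, exists v, c v = i) /\
  (forall i j v, c v = i -> #|[set u | adj v u & c u == j]|%:R = S i j).

Definition perfect_structure (R : realType) (n m : nat)
    (A : 'M[R]_n) (f : 'M[R]_(n, m)) (S : 'M[R]_m) : Prop :=
  A *m f = f *m S.

(* Rows are indexed by 'I_n through an enumeration e of the vertices; the row
   of the vertex v is its color, i.e., the unit vector e_(c v). *)
Definition coloring_mx (R : realType) (V : Type) (n nu : nat)
    (e : 'I_n -> V) (c : V -> 'I_nu) : 'M[R]_(n, nu) :=
  \matrix_(k < n) delta_mx 0 (c (e k)).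

(* The enumeration of pairs that tensmx ( *t ) uses for its rows. *)
Definition pair_enum (V1 V2 : finType) (k : 'I_(#|V1| * #|V2|)) : V1 * V2 :=
  (enum_val (mxtens_unindex k).1, enum_val (mxtens_unindex k).2).

Definition distribution (R : realType) (n mu nu : nat)
    (g : 'M[R]_(n, mu)) (f : 'M[R]_(n, nu)) : 'M[R]_(mu, nu) :=
  g^T *m f.

(* The column k of the result stands for the pair (i'', j), in the order used
   by tensmx: i'' comes from the first factor, j from the second. *)
Definition rearrange (R : realType) (mu1 mu2 nu : nat)
    (h : 'M[R]_(mu1 * mu2, nu)) : 'M[R]_(mu1, mu2 * nu) :=
  \matrix_(i < mu1, k < mu2 * nu)
    h (mxtens_index (i, (mxtens_unindex k).1)) (mxtens_unindex k).2.

(* Main.v *)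
Require Import Defs.
From mathcomp Require Import all_boot all_order all_algebra.
From mathcomp Require Import mxtens.
From mathcomp Require Import reals.

Set Implicit Arguments.
Unset Strict Implicit.
Unset Printing Implicit Defensive.

Import GRing.Theory.
Local Open Scope ring_scope.

(** Let A', A'' and A be the adjacency matrices of G', G'' and G' x G''.  Then
    A = A' *t 1 + 1 *t A'' ([adj_mx_cartesian]).  A perfect coloring is a
    perfect structure over the adjacency matrix
    ([perfect_structure_coloring_mx]), so A' g' = g' R' and A'' g'' = g'' R'',
    whence g' *t g'' is perfect over A with parameter matrix
    R' *t 1 + 1 *t R'' ([perfect_structure_tens]).  Since A is symmetric, the
    product (g' *t g'')^T A f can be evaluated from either side, and this gives
    (R' *t 1 + 1 *t R'')^T h = h S ([perfect_structure_distribution]).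

    Rearranging this identity finishes the proof: on h* the factor acting on
    the index i' stays on the left, while the factors acting on i'' and on j
    move to the right ([rearrange_mull], [rearrange_mulm], [rearrange_mulr]).
    The result is R'^T h* + h* (R'' *t 1) = h* (1 *t S). *)

Lemma sum_mxtens (V : nmodType) (m n : nat) (F : 'I_(m * n) -> V) :
  \sum_k F k = \sum_i \sum_j F (mxtens_index (i, j)).
Proof.
rewrite pair_big; apply: reindex => /=.
exists (@mxtens_unindex m n) => i _; last exact: mxtens_unindexK.
by case: i => i j; exact: mxtens_indexK.
Qed.

(** * Adjacency matrices *)

Definition adj_mx (R : realType) (G : sgraph) n (e : 'I_n -> G) : 'M[R]_n :=
  \matrix_(k, l) (adj (e k) (e l))%:R.

Lemma tr_adj_mx (R : realType) (G : sgraph) n (e : 'I_n -> G) :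
  (adj_mx R e)^T = adj_mx R e.
Proof. by apply/matrixP => k l; rewrite !mxE adj_sym. Qed.

Lemma pair_enum_bij (V1 V2 : finType) : bijective (@pair_enum V1 V2).
Proof.
exists (fun u => mxtens_index (enum_rank u.1, enum_rank u.2)) => [k|[a b]].
  by rewrite /pair_enum /= !enum_valK; exact: (mxtens_unindexK k).
by rewrite /pair_enum mxtens_indexK /= !enum_rankK.
Qed.

(** The two kinds of edges of the cartesian product exclude each other because
    the factors have no loops, so the disjunction becomes a sum. *)
Lemma adj_mx_cartesian (R : realType) (G1 G2 : sgraph) :
  adj_mx R (@pair_enum G1 G2 : _ -> cartesian G1 G2) =
  adj_mx R (@enum_val G1 predT) *t 1%:M + 1%:M *t adj_mx R (@enum_val G2 predT).
Proof.
apply/matrixP => k l; case: (mxtens_indexP k) => k1 k2.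
case: (mxtens_indexP l) => l1 l2.
rewrite [RHS]mxE !tensmxE !mxE /= /cart_adj /pair_enum !mxtens_indexK /=.
rewrite !(inj_eq enum_val_inj) -!natrM -natrD; congr _%:R.
have [<-|_] := eqVneq k1 l1; first by rewrite adj_irrefl orbF mul1n.
by rewrite mul0n addn0 mulnb.
Qed.

Lemma perfect_structure_coloring_mx (R : realType) (G : sgraph) n nu
    (e : 'I_n -> G) (S : 'M[R]_nu) (c : G -> 'I_nu) :
  bijective e -> perfect_coloring S c ->
  perfect_structure (adj_mx R e) (coloring_mx R e c) S.
Proof.
move=> bij_e [_ cP]; apply/matrixP => k j; rewrite !mxE.
transitivity (S (c (e k)) j).
  rewrite -(cP _ j (e k) erefl) -sum1_card natr_sum (reindex e) /=; last first.
    exact: onW_bij.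
  rewrite [RHS]big_mkcond /=; apply: eq_bigr => l _.
  by rewrite !mxE inE eqxx eq_sym; case: (adj _ _); case: eqP => _;
    rewrite ?mul0r ?mulr0 ?mulr1.
rewrite (bigD1 (c (e k))) //= !mxE !eqxx mul1r big1 ?addr0 // => i neq_i.
by rewrite !mxE (negPf neq_i) andbF mul0r.
Qed.

(** * Perfect structures *)

Lemma perfect_structure_tens (R : realType) n1 n2 m1 m2
    (A1 : 'M[R]_n1) (A2 : 'M[R]_n2) (f1 : 'M[R]_(n1, m1)) (f2 : 'M[R]_(n2, m2))
    (S1 : 'M[R]_m1) (S2 : 'M[R]_m2) :
  perfect_structure A1 f1 S1 -> perfect_structure A2 f2 S2 ->
  perfect_structure (A1 *t 1%:M + 1%:M *t A2) (f1 *t f2)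
                    (S1 *t 1%:M + 1%:M *t S2).
Proof.
rewrite /perfect_structure => f1P f2P.
by rewrite mulmxDl mulmxDr !tensmx_mul f1P f2P !mul1mx !mulmx1.
Qed.

(** Both sides equal g^T A f, evaluated with A acting on g or on f. *)
Lemma perfect_structure_distribution (R : realType) n mu nu (A : 'M[R]_n)
    (g : 'M[R]_(n, mu)) (f : 'M[R]_(n, nu)) (T : 'M[R]_mu) (S : 'M[R]_nu) :
  A^T = A -> perfect_structure A g T -> perfect_structure A f S ->
  perfect_structure T^T (distribution g f) S.
Proof.
rewrite /perfect_structure /distribution => trA gP fP.
by rewrite mulmxA -trmx_mul -gP trmx_mul trA -!mulmxA fP.
Qed.

(** * Rearrangement *)

Section Rearrange.
Variables (R : realType) (mu1 mu2 nu : nat).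
Implicit Type h : 'M[R]_(mu1 * mu2, nu).

Lemma rearrangeE h i1 i2 j :
  rearrange h i1 (mxtens_index (i2, j)) = h (mxtens_index (i1, i2)) j.
Proof. by rewrite mxE mxtens_indexK. Qed.

Lemma rearrangeD h h' : rearrange (h + h') = rearrange h + rearrange h'.
Proof. by apply/matrixP => i k; rewrite !mxE. Qed.

Lemma rearrange_mull (B : 'M[R]_mu1) h :
  rearrange ((B *t 1%:M) *m h) = B *m rearrange h.
Proof.
apply/matrixP => i k; case: (mxtens_indexP k) => i2 j {k}.
rewrite rearrangeE !mxE sum_mxtens; apply: eq_bigr => l1 _.
rewrite rearrangeE (bigD1 i2) //= tensmxE mxE eqxx mulr1 big1 ?addr0 //.
move=> l2 neq_l2; rewrite tensmxE mxE eq_sym (negPf neq_l2).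
by rewrite mulr0 mul0r.
Qed.

(** The index i'' passes from the rows to the columns, which transposes the
    matrix acting on it. *)
Lemma rearrange_mulm (B : 'M[R]_mu2) h :
  rearrange ((1%:M *t B^T) *m h) = rearrange h *m (B *t 1%:M).
Proof.
apply/matrixP => i k; case: (mxtens_indexP k) => i2 j {k}.
rewrite rearrangeE !mxE !sum_mxtens (bigD1 i) //= [X in _ + X]big1 ?addr0.
  apply: eq_bigr => l2 _; rewrite tensmxE !mxE eqxx mul1r.
  rewrite (bigD1 j) //= rearrangeE tensmxE mxE eqxx mulr1 [X in _ + X]big1.
    by rewrite addr0 mulrC.
  by move=> l neq_l; rewrite tensmxE [1%:M _ _]mxE (negPf neq_l) !mulr0.
move=> l1 neq_l1; apply: big1 => l2 _.
by rewrite tensmxE mxE eq_sym (negPf neq_l1) !mul0r.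
Qed.

Lemma rearrange_mulr h (S : 'M[R]_nu) :
  rearrange (h *m S) = rearrange h *m (1%:M *t S).
Proof.
apply/matrixP => i k; case: (mxtens_indexP k) => i2 j {k}.
rewrite rearrangeE !mxE sum_mxtens (bigD1 i2) //= [X in _ = _ + X]big1 ?addr0.
  by apply: eq_bigr => l _; rewrite rearrangeE tensmxE mxE eqxx mul1r.
move=> l2 neq_l2; apply: big1 => l _.
by rewrite tensmxE [1%:M _ _]mxE (negPf neq_l2) mul0r mulr0.
Qed.

End Rearrange.

Theorem theorem8 (R : realType) (G1 G2 : sgraph) (mu1 mu2 nu : nat)
    (R1 : 'M[R]_mu1) (R2 : 'M[R]_mu2) (S : 'M[R]_nu)
    (g1 : G1 -> 'I_mu1) (g2 : G2 -> 'I_mu2) (f : cartesian G1 G2 -> 'I_nu)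
    (g1P : perfect_coloring R1 g1)
    (g2P : perfect_coloring R2 g2)
    (fP : perfect_coloring S f) :
  let g := coloring_mx R (@enum_val G1 predT) g1
             *t coloring_mx R (@enum_val G2 predT) g2 in
  let h := distribution g (coloring_mx R (@pair_enum G1 G2) f) in
  perfect_structure R1^T (rearrange h) (1%:M *t S - R2 *t 1%:M).
Proof.
move=> g h.
have fA := perfect_structure_coloring_mx (G := cartesian G1 G2)
  (@pair_enum_bij G1 G2) fP.
have gA : perfect_structure (adj_mx R (@pair_enum G1 G2 : _ -> cartesian G1 G2))
    g (R1 *t 1%:M + 1%:M *t R2).
  rewrite adj_mx_cartesian; apply: perfect_structure_tens;
    by apply: perfect_structure_coloring_mx => //; exact: enum_val_bij.
have hP := perfect_structure_distribution (tr_adj_mx R _) gA fA.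
have := congr1 (@rearrange R mu1 mu2 nu) hP.
rewrite linearD /= !trmx_tens !trmx1 mulmxDl rearrangeD.
rewrite rearrange_mull rearrange_mulm rearrange_mulr => hE.
by rewrite /perfect_structure mulmxBr -hE addrK.
Qed.
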